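(* Let $A,B$ be finite sets, let $R$ be a Laurent-generated subsemiring of $\mathbb Z^A_{\mathrm{pos}}\cup\{-\infty\}$, and let $\nu: R\to \mathbb Z^B_{\mathrm{pos}}\cup\{-\infty\}$ be a semiring homomorphism. Then $\nu$ is geometric.
   Context: A semiring $(R,+,\cdot,0,1)$ is a set with commutative monoids $(R,+,0)$ and $(R,\cdot,1)$ such that multiplication distributes over addition and $0\cdot a=0$ for all $a$. Semiring homomorphisms preserve $+,\cdot,0,1$. A subsemiring is a subset that is a semiring under the same operations (containing the same $0$ and $1$); $\langle S\rangle$ denotes the smallest subsemiring containing $S$. $R^\times$ is the group of multiplicatively invertible elements. The semiring $\mathbb Z^A_{\mathrm{pos}}\cup\{-\infty\}$: for a finite set $A$, $(\mathbb Z\cup\{-\infty\})^A$ is the set of maps $A\to\mathbb Z\cup\{-\infty\}$, with addition $(F\oplus G)(a)=\max\{F(a),G(a)\}$ and multiplication $(F\odot G)(a)=F(a)+G(a)$. Its additive identity is the constant map $-\infty$ and its multiplicative identity is the constant map $0$. The degree is $\deg F=\sum_{a\in A}F(a)$. Put $\mathbb Z^A_{\mathrm{pos}}=\{F\mid \deg F\ge 0\}$ and $\mathbb Z^A_0=\{F\mid\deg F=0\}$ (so all values are integers in both cases). Writing $-\infty$ for the constant map $-\infty$, $\mathbb Z^A_{\mathrm{pos}}\cup\{-\infty\}$ is a subsemiring of $(\mathbb Z\cup\{-\infty\})^A$, and its unit group is $\mathbb Z^A_0$. Laurent-generated: for a semiring $R_0$ and a subset $S\subset R_0^\times$, with $S^{-1}=\{s^{-1}\mid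 s\in S\}$, the subsemiring $\langle S\cup S^{-1}\rangle$ is said to be Laurent-generated by $S$, and $S$ is called a Laurent-generating set of it. A Laurent-generated subsemiring is one that is Laurent-generated by some set. (Every Laurent-generated subsemiring of $\mathbb Z^A_{\mathrm{pos}}\cup\{-\infty\}$ has a finite Laurent-generating set.) Geometric: let $R$ be a Laurent-generated subsemiring of $\mathbb Z^A_{\mathrm{pos}}\cup\{-\infty\}$ and $\nu:R\to\mathbb Z^B_{\mathrm{pos}}\cup\{-\infty\}$ a semiring homomorphism. For a finite subset $S\subset R\cap\mathbb Z^A_0$, $\nu$ is geometric with respect to $S$ if for every $b\in B$ there exist $a\in A$ and a nonnegative rational number $t$ such that $\nu(F)(b)=tF(a)$ for all $F\in S$. The homomorphism $\nu$ is geometric if it is geometric with respect to some (finite) Laurent-generating set of $R$. *)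

(* Defs.v *)
From HB Require Import structures.
From mathcomp Require Import all_boot all_order all_algebra.
From mathcomp Require Import boolp classical_sets cardinality.

Set Implicit Arguments.
Unset Strict Implicit.
Unset Printing Implicit Defensive.

Import Order.TTheory GRing.Theory Num.Theory.

Local Open Scope classical_set_scope.
Local Open Scope ring_scope.

(* The max-plus semiring on the integers extended by -oo, which is None.  Its
   ring_scope + is max and its * is integer addition, so 0 is -oo and 1 is the
   integer 0. *)
Definition trop : Type := option int.

HB.instance Definition _ := Choice.on trop.

Definition trop_add (x y : trop) : trop :=
  match x, y with
  | Some m, Some n => Some (Order.max m n)
  | None, _ => y
  | _, None => x
  end.

Definition trop_mul (x y : trop) : trop :=
  match x, y with
  | Some m, Some n => Some (m + n)
  | _, _ => None
  end.

Fact trop_addA : associative trop_add.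
Proof. by move=> [x|] [y|] [z|] //=; rewrite maxA. Qed.

Fact trop_addC : commutative trop_add.
Proof. by move=> [x|] [y|] //=; rewrite maxC. Qed.

Fact trop_add0 : left_id None trop_add.
Proof. by case. Qed.

Fact trop_mulA : associative trop_mul.
Proof. by move=> [x|] [y|] [z|] //=; rewrite addrA. Qed.

Fact trop_mulC : commutative trop_mul.
Proof. by move=> [x|] [y|] //=; rewrite addrC. Qed.

Fact trop_mul1 : left_id (Some 0) trop_mul.
Proof. by move=> [x|] //=; rewrite add0r. Qed.

Fact trop_mulDl : left_distributive trop_mul trop_add.
Proof. by move=> [x|] [y|] [z|] //=; rewrite addr_maxl. Qed.

Fact trop_mul0 : left_zero None trop_mul.
Proof. by []. Qed.

HB.instance Definition _ :=
  GRing.isNmodule.Build trop trop_addA trop_addC trop_add0.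
HB.instance Definition _ :=
  GRing.Nmodule_isComPzSemiRing.Build trop
    trop_mulA trop_mulC trop_mul1 trop_mulDl trop_mul0.

Fact ffun_trop_mulC (A : finType) :
  commutative (@GRing.mul ({ffun A -> trop} : pzSemiRingType)).
Proof. by move=> F G; apply/ffunP => a; rewrite !ffunE mulrC. Qed.

HB.instance Definition _ (A : finType) :=
  GRing.PzSemiRing_hasCommutativeMul.Build {ffun A -> trop}
    (@ffun_trop_mulC A).

(* The product of trop is integer addition, so this is the sum of the values
   of F; it is -oo as soon as one of them is. *)
Definition deg (A : finType) (F : {ffun A -> trop}) : trop := \prod_a F a.

Definition Zpos (A : finType) : {pred {ffun A -> trop}} :=
  [pred F | if deg F is Some n then 0 <= n else false].

Definition Zzero (A : finType) : {pred {ffun A -> trop}} :=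
  [pred F | deg F == Some 0].

Definition Zpos_ninfty (A : finType) : {pred {ffun A -> trop}} :=
  [predU1 0 & @Zpos A].

Lemma deg_SomeE (A : finType) (F : {ffun A -> trop}) n :
  deg F = Some n ->
  (forall a, exists m, F a = Some m) /\ n = \sum_a odflt 0 (F a).
Proof.
move=> dF.
have FS a : exists m, F a = Some m.
  case Fa: (F a) => [m|]; first by exists m.
  by move: dF; rewrite /deg (bigD1 a) //= Fa.
split=> //; apply: Some_inj; rewrite -dF /deg.
apply: (big_rec2 (fun x y => x = Some y)) => // a y x _ ->.
by have [m ->] := FS a.
Qed.

Lemma deg_Some (A : finType) (F : {ffun A -> trop}) :
  (forall a, exists m, F a = Some m) -> deg F = Some (\sum_a odflt 0 (F a)).
Proof.
move=> FS; apply: (big_rec2 (fun x y => x = Some y)) => // a y x _ ->.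
by have [m ->] := FS a.
Qed.

Fact Zpos_ninfty_closed (A : finType) : semiring_closed (@Zpos_ninfty A).
Proof.
split; split.
- by rewrite !inE eqxx.
- move=> F G /predU1P[->|posF]; first by rewrite add0r.
  case/predU1P=> [->|posG]; first by rewrite addr0 !inE; apply/orP; right.
  apply/predU1P; right; move: posF posG; rewrite !inE.
  case dF: (deg F) => [m|//] m0; case dG: (deg G) => [n|//] _.
  have [FS mE] := deg_SomeE dF; have [GS _] := deg_SomeE dG.
  rewrite deg_Some => [|a]; last first.
    have [x Fa] := FS a; have [y Ga] := GS a.
    by exists (Order.max x y); rewrite ffunE Fa Ga.
  rewrite (le_trans m0) // mE ler_sum // => a _.
  have [x Fa] := FS a; have [y Ga] := GS a.
  by rewrite ffunE Fa Ga /= le_max lexx.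
- apply/predU1P; right; rewrite !inE.
  by rewrite /deg big1 // => a _; rewrite ffunE.
- move=> F G /predU1P[->|posF]; first by rewrite mul0r !inE eqxx.
  case/predU1P=> [->|posG]; first by rewrite mulr0 !inE eqxx.
  apply/predU1P; right; move: posF posG; rewrite !inE.
  have -> : deg (F * G) = deg F * deg G.
    by rewrite /deg -big_split; apply: eq_bigr => a _; rewrite ffunE.
  by case: (deg F) => [m|//]; case: (deg G) => [n|//]; apply: addr_ge0.
Qed.

Definition posSemiring (A : finType) : Type :=
  {F : {ffun A -> trop} | F \in @Zpos_ninfty A}.

HB.instance Definition _ (A : finType) := SubChoice.on (posSemiring A).
HB.instance Definition _ (A : finType) :=
  GRing.SubChoice_isSubComPzSemiRing.Build {ffun A -> trop} _ (posSemiring A)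
    (@Zpos_ninfty_closed A).

(* A subsemiring is a bundled predicate R : semiringClosed T, and this is its
   carrier.  Every set closed under the operations gives such an R, classical
   comprehension turning it into a boolean predicate. *)
Definition subsemiring (T : comPzSemiRingType) (R : semiringClosed T) : Type :=
  {x : T | x \in R}.

HB.instance Definition _ (T : comPzSemiRingType) (R : semiringClosed T) :=
  SubChoice.on (subsemiring R).
HB.instance Definition _ (T : comPzSemiRingType) (R : semiringClosed T) :=
  GRing.SubChoice_isSubComPzSemiRing.Build T _ (subsemiring R)
    (GRing.semiringClosedP R).

Definition generated_subsemiring (T : pzSemiRingType) (S : set T) : set T :=
  smallest [set M : set T | semiring_closed (mem M)] S.

Definition invertible (T : pzSemiRingType) : set T :=
  [set x | exists y, x * y = 1].

(* Multiplication being commutative, a right inverse is the inverse. *)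
Definition inverses (T : comPzSemiRingType) (S : set T) : set T :=
  [set y | exists2 x, S x & x * y = 1].

Definition laurent_generates (T : comPzSemiRingType) (S : set T)
    (R : semiringClosed T) : Prop :=
  S `<=` @invertible T /\
  [set x | x \in R] = generated_subsemiring (S `|` inverses S).

Definition laurent_generated (T : comPzSemiRingType)
    (R : semiringClosed T) : Prop :=
  exists S : set T, laurent_generates S R.

Section Geometric.
Variables (A B : finType) (R : semiringClosed (posSemiring A)).
Variable nu : {rmorphism subsemiring R -> posSemiring B}.

(* The equation nu(F)(b) = t F(a) is read in the rationals; both sides are
   images of Some, since F and nu F are invertible and so have no value -oo. *)
Definition geometric_wrt (S : set (posSemiring A)) : Prop :=
  [/\ finite_set S,
      S `<=` [set F | F \in R /\ val F \in @Zzero A] &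
      forall b : B, exists (a : A) (t : rat), 0 <= t /\
        forall F : subsemiring R, S (val F) ->
          omap (fun n : int => n%:~R : rat) (val (nu F) b) =
          omap (fun m : int => t * m%:~R) (val (val F) a)].

Definition geometric : Prop :=
  exists S : set (posSemiring A), laurent_generates S R /\ geometric_wrt S.

End Geometric.

(* Main.v *)
Require Import Defs.
From HB Require Import structures.
From mathcomp Require Import all_boot all_order all_algebra.
From mathcomp Require Import boolp classical_sets cardinality.

Set Implicit Arguments.
Unset Strict Implicit.
Unset Printing Implicit Defensive.

Import Order.TTheory GRing.Theory Num.Theory.

Local Open Scope ring_scope.

(** The units of R are tropical vectors: an invertible F has integer values, so
    it is the image of some f : A -> int, and these f form a subgroup H of Z^A
    (unit_exponents).

    A finite Laurent-generating set exists because H, being a subgroup of Z^A,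
    is finitely generated (subgroup_fg).  Every Laurent-generating set of R has
    its exponents in H, so finitely many generators of the group H already
    Laurent-generate R (finite_laurent_generating).

    For b in B, the map phi sending f to nu(f)(b) is a group homomorphism from
    H to Z, as are the evaluations e_a at the points a of A.  The claim is that
    phi is a nonnegative rational multiple of some e_a on H.  Otherwise, for
    each a, the one-ray case of Farkas' lemma (collinear_or_separated) gives
    u_a in H with e_a(u_a) >= 0 and phi(u_a) < 0.  Then X := \sum_a u_a is the
    pointwise maximum of the u_a; it is nonnegative at every point, which in
    the semiring reads 1 + X = X.  Applying nu and evaluating at b turns this
    into the assertion that 0 is at most the maximum of the phi(u_a), a
    maximum of negative integers: a contradiction (valuation_at_ray).  Since
    the multiple is found on all of H, nu is geometric with respect to any
    finite set of units that Laurent-generates R. *)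

(** * Homomorphisms from abelian groups to the integers *)

(** Farkas' lemma for a cone spanned by one ray.  If nothing separates phi from
    e, then phi is nonnegative where e is, so it vanishes on the kernel of e.
    The multiple t is then read off at any point x0 with e x0 > 0, because
    (e x) x0 - (e x0) x lies in that kernel; without such a point e and phi are
    both 0. *)
Lemma collinear_or_separated (U : zmodType) (phi e : {additive U -> int}) :
  (exists t : rat, 0 <= t /\ forall x, (phi x)%:~R = t * (e x)%:~R) \/
  (exists x, 0 <= e x /\ phi x < 0).
Proof.
have [[x [ex px]]|nosep] := pselect (exists x, 0 <= e x /\ phi x < 0).
  by right; exists x.
have pos x : 0 <= e x -> 0 <= phi x.
  by move=> ex; rewrite leNgt; apply/negP => px; apply: nosep; exists x.
have ker x : e x = 0 -> phi x = 0.
  move=> ex; apply/eqP; rewrite eq_le pos ?ex // andbT.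
  by rewrite -oppr_ge0 -raddfN pos // raddfN ex oppr0.
left.
have [[x0 ex0]|e0] := pselect (exists x, 0 < e x).
  exists ((phi x0)%:~R / (e x0)%:~R); split.
    by rewrite divr_ge0 // ler0z ?pos ?ltW.
  move=> x; have := ker (x0 *~ e x - x *~ e x0).
  rewrite !raddfB !(raddfMz e) !(raddfMz phi) !mulrzz mulrC subrr.
  move=> /(_ erefl)/subr0_eq.
  move=> E; rewrite mulrAC -intrM E intrM mulfK //.
  by rewrite intr_eq0 gt_eqF.
exists 0; split=> // x; rewrite mul0r ker //.
apply/eqP; rewrite eq_le -[_ <= 0]oppr_ge0 -raddfN.
have nle y : e y <= 0 by rewrite leNgt; apply/negP => ey; apply: e0; exists y.
by rewrite raddfN oppr_ge0 nle /= -oppr_le0 -raddfN nle.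
Qed.

(** Induction on the coordinates es: the subgroup of H where the first one, e,
    vanishes is finitely generated, and it suffices to add an element x0 of H
    whose value at e has the least nonzero absolute value, since Euclidean
    division by e x0 moves any element of H into that subgroup.  Generation is
    expressed by minimality among subgroups, so no integer combinations have
    to be written down. *)
Lemma subgroup_fg (V : zmodType) (es : seq {additive V -> int})
    (H : zmodClosed V) :
  (forall x, x \in H -> all (fun e : {additive V -> int} => e x == 0) es ->
     x = 0) ->
  exists g : seq V, {subset g <= H} /\
    forall K : zmodClosed V, {subset g <= K} -> {subset H <= K}.
Proof.
elim: es H => [|e es IHes] H inj.
  exists [::]; split=> // K _ x /inj -> //; exact: rpred0.
pose kerH : {pred V} := [pred x | (x \in H) && (e x == 0)].
have kerH_closed : zmod_closed kerH.
  split; first by rewrite inE rpred0 raddf0 eqxx.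
  move=> x y /andP[xH /eqP ex] /andP[yH /eqP ey].
  by rewrite inE rpredB // raddfB ex ey subrr eqxx.
pose H' : zmodClosed V :=
  HB.pack kerH (GRing.isZmodClosed.Build V kerH kerH_closed).
have [x /andP[xH ex] es0|g [gH gK]] := IHes H'.
  by apply: inj => //=; rewrite ex.
pose P n := `[< exists x, x \in H /\ `|e x|%N = n.+1 >].
have [[n Pn]|noP] := pselect (exists n, P n); last first.
  exists g; split=> [x /gH /andP[] //|K /gK HK x xH].
  apply: HK; apply/andP; split=> //.
  apply/negPn/negP => ex; apply: noP; exists `|e x|%N.-1; apply/asboolP.
  by exists x; split=> //; rewrite prednK // absz_gt0.
have exP : exists n, P n by exists n.
case: (ex_minnP exP) => m /asboolP[x0 [x0H ex0]] min_m {n Pn}.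
have ex0n0 : e x0 != 0 by rewrite -absz_gt0 ex0.
exists (x0 :: g); split.
  by move=> x; rewrite inE => /predU1P[->//|/gH/andP[]].
move=> K sgK x xH.
have x0K : x0 \in K by apply: sgK; rewrite mem_head.
have mulzP (L : zmodClosed V) y k : y \in L -> y *~ k \in L.
  by case: k => k yL; [exact: rpredMn | exact: rpredMNn].
pose q := (e x %/ e x0)%Z; pose y := x - x0 *~ q.
have eyE : e y = (e x %% e x0)%Z.
  by rewrite raddfB (raddfMz e) mulrzz mulrC /modz.
rewrite -[x](subrK (x0 *~ q)) -/y rpredD ?mulzP //.
have yH : y \in H by rewrite rpredB ?mulzP.
apply: gK => [z zg|]; first by apply: sgK; rewrite inE zg orbT.
apply/andP; split=> //; apply/negPn/negP => ey.
(* A nonzero remainder e y would contradict the choice of x0, whose value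
   has absolute value m.+1. *)
suff : (m <= `|e y|.-1)%N.
  rewrite -ltnS prednK ?absz_gt0 // leqNgt -ex0 eyE => /negP; apply.
  by rewrite -ltz_nat gez0_abs ?modz_ge0 // ltz_mod.
apply: min_m; apply/asboolP; exists y; split=> //.
by rewrite prednK // absz_gt0.
Qed.

(** * Integer vectors as tropical vectors *)

(** In trop the relation 1 + y = y says that the integer 0 is at most y, which
    fails for a maximum y of negative integers, and also for the empty maximum
    -oo. *)
Lemma trop_sum_lt0 (I : finType) (c : I -> int) :
  (forall i, c i < 0) ->
  1 + \sum_i (Some (c i) : trop) != \sum_i (Some (c i) : trop).
Proof.
move=> c_lt0.
have : if \sum_i (Some (c i) : trop) is Some m then m < 0 else true.
  elim/big_ind: _ => // [[m|] [n|] //= m0 n0].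
  by rewrite gt_max m0.
case: (\sum_i _) => [m|] // m0.
apply/eqP => -[] /eqP; rewrite max_l ?(ltW m0) // => /eqP m0'.
by rewrite -m0' ltxx in m0.
Qed.

Definition trop_vec (A : finType) (f : {ffun A -> int}) : {ffun A -> trop} :=
  [ffun a => Some (f a)].

Section TropVec.
Variable A : finType.
Implicit Types f g : {ffun A -> int}.

Lemma trop_vec0 : trop_vec 0 = 1 :> {ffun A -> trop}.
Proof. by apply/ffunP => a; rewrite !ffunE. Qed.

Lemma trop_vecD f g : trop_vec (f + g) = trop_vec f * trop_vec g.
Proof. by apply/ffunP => a; rewrite !ffunE. Qed.

Lemma deg_trop_vec f : deg (trop_vec f) = Some (\sum_a f a).
Proof.
rewrite deg_Some => [|a]; last by exists (f a); rewrite ffunE.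
by congr Some; apply: eq_bigr => a _; rewrite ffunE.
Qed.

(** The constant -oo is a tropical vector of integers only if A is empty, and
    then the sum is 0. *)
Lemma trop_vec_sum_ge0 f : trop_vec f \in @Zpos_ninfty A -> 0 <= \sum_a f a.
Proof.
case/predU1P=> [f0|]; last by rewrite inE deg_trop_vec.
by rewrite big1 // => a _; have /ffunP/(_ a) := f0; rewrite !ffunE.
Qed.

(** In trop, -oo is not invertible and the inverse of an integer is its
    opposite. *)
Lemma mulf_eq1_trop_vec (F G : {ffun A -> trop}) : F * G = 1 ->
  exists f, F = trop_vec f /\ G = trop_vec (- f).
Proof.
move=> /ffunP FG1; exists [ffun a => odflt 0 (F a)].
have FG a : exists2 m, F a = Some m & G a = Some (- m).
  have := FG1 a; rewrite !ffunE; case: (F a) (G a) => [m|] [n|] //= [] mn.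
  by exists m => //; rewrite -[n](addKr m) mn addr0.
by split; apply/ffunP => a; have [m Fa Ga] := FG a; rewrite !ffunE Fa ?Ga.
Qed.

(** Evaluation at a, named so as to carry its structure of group
    homomorphism. *)
Definition coord (a : A) f : int := f a.

Fact coordB a : zmod_morphism (coord a).
Proof. by move=> f g; rewrite /coord !ffunE. Qed.

HB.instance Definition _ a :=
  GRing.isZmodMorphism.Build {ffun A -> int} int (coord a) (coordB a).

End TropVec.

(** * The unit group of a subsemiring *)

Section UnitExponents.
Variables (A : finType) (R : semiringClosed (posSemiring A)).

(** The inclusion of R into the tropical vectors, as one semiring homomorphism
    instead of two nested subtype projections. *)
Definition trop_val (F : subsemiring R) : {ffun A -> trop} := val (val F).

Fact trop_val_nmod_morphism : nmod_morphism trop_val.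
Proof. by split=> [|F G]; rewrite /trop_val ?raddf0 ?raddfD. Qed.

Fact trop_val_monoid_morphism : monoid_morphism trop_val.
Proof. by split=> [|F G]; rewrite /trop_val ?rmorph1 ?rmorphM. Qed.

HB.instance Definition _ := GRing.isNmodMorphism.Build
  (subsemiring R) {ffun A -> trop} trop_val trop_val_nmod_morphism.
HB.instance Definition _ := GRing.isMonoidMorphism.Build
  (subsemiring R) {ffun A -> trop} trop_val trop_val_monoid_morphism.

Lemma trop_val_inj : injective trop_val.
Proof. by move=> F G /val_inj/val_inj. Qed.

Definition unit_exponents : {pred {ffun A -> int}} :=
  [pred f | `[< exists F G : subsemiring R,
     trop_val F = trop_vec f /\ trop_val G = trop_vec (- f) >]].

Fact unit_exponents_closed : zmod_closed unit_exponents.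
Proof.
split=> [|f g].
  by apply/asboolP; exists 1, 1; rewrite oppr0 trop_vec0.
move=> /asboolP[F [F' [Ff F'f]]] /asboolP[G [G' [Gg G'g]]].
apply/asboolP; exists (F * G'), (F' * G).
rewrite !rmorphM /= Ff F'f Gg G'g -!trop_vecD; split=> //.
by rewrite opprB addrC.
Qed.

Lemma unit_exponentsP f :
  reflect (exists F G : posSemiring A,
      [/\ F \in R, G \in R, val F = trop_vec f & val G = trop_vec (- f)])
    (f \in unit_exponents).
Proof.
apply: (iffP (asboolP _)) => [[F [G [Ff Gf]]]|[F [G [FR GR Ff Gf]]]].
  by exists (val F), (val G); split; rewrite // (valP F, valP G).
by exists (Sub F FR), (Sub G GR).
Qed.

Lemma mulr_eq1_unit_exponent (x y : posSemiring A) :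
    x \in R -> y \in R -> x * y = 1 ->
  exists f, [/\ f \in unit_exponents, val x = trop_vec f
               & val y = trop_vec (- f)].
Proof.
move=> xR yR /(congr1 val); rewrite rmorphM rmorph1.
move=> /mulf_eq1_trop_vec[f [xf yf]].
by exists f; split=> //; apply/unit_exponentsP; exists x, y.
Qed.

(** Both F and its inverse have nonnegative degree, and these degrees are
    opposite. *)
Lemma unit_exponent_deg0 (F : posSemiring A) f :
  f \in unit_exponents -> val F = trop_vec f -> val F \in @Zzero A.
Proof.
move=> /unit_exponentsP[F' [G [_ _ F'f Gf]]] Ff; rewrite inE Ff deg_trop_vec.
apply/eqP; congr Some; apply/eqP; rewrite eq_le trop_vec_sum_ge0 ?andbT.
  rewrite -oppr_ge0 -sumrN.
  have := trop_vec_sum_ge0 (f := - f); rewrite -Gf => /(_ (valP G)).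
  by under eq_bigr do rewrite ffunE.
by rewrite -Ff; exact: valP F.
Qed.

HB.instance Definition _ :=
  GRing.isZmodClosed.Build {ffun A -> int} unit_exponents
    unit_exponents_closed.

(** The group of units of R, written additively through exponents. *)
Definition unit_group : Type := {f | f \in unit_exponents}.

HB.instance Definition _ := SubChoice.on unit_group.
HB.instance Definition _ := [SubChoice_isSubZmodule of unit_group by <:].

Lemma monomial_subproof (u : unit_group) :
  exists F : subsemiring R, trop_val F = trop_vec (val u).
Proof. by case/asboolP: (valP u) => F [G [Ff _]]; exists F. Qed.

Definition monomial (u : unit_group) : subsemiring R :=
  projT1 (cid (monomial_subproof u)).

Lemma monomialE u : trop_val (monomial u) = trop_vec (val u).
Proof. by rewrite /monomial; case: cid. Qed.

Lemma monomial0 : monomial 0 = 1.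
Proof. by apply: trop_val_inj; rewrite monomialE raddf0 trop_vec0. Qed.

Lemma monomialD u v : monomial (u + v) = monomial u * monomial v.
Proof.
apply: trop_val_inj.
by rewrite rmorphM /= !monomialE -trop_vecD -raddfD.
Qed.

(** * Homomorphisms to vectors, one coordinate at a time *)

Section Valuation.
Variables (B : finType) (nu : {rmorphism subsemiring R -> posSemiring B}).
Variable b : B.

(** The default value 0 is never taken, by valuation_atE. *)
Definition valuation_at (u : unit_group) : int :=
  odflt 0 (val (nu (monomial u)) b).

(** A homomorphism sends units to units, and these have no value -oo. *)
Lemma valuation_atE u : val (nu (monomial u)) b = Some (valuation_at u).
Proof.
have : val (nu (monomial u)) * val (nu (monomial (- u))) = 1.
  by rewrite -!rmorphM -monomialD subrr monomial0 !rmorph1.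
move/ffunP/(_ b); rewrite /valuation_at !ffunE.
by case: (\val (nu (monomial u)) b).
Qed.

Lemma valuation_atB : zmod_morphism valuation_at.
Proof.
move=> u v; apply/eqP; rewrite eq_sym subr_eq; apply/eqP/Some_inj.
rewrite -valuation_atE -[X in monomial X](subrK v) monomialD !rmorphM ffunE.
by rewrite !valuation_atE.
Qed.

HB.instance Definition _ :=
  GRing.isZmodMorphism.Build unit_group int valuation_at valuation_atB.

(** The heart of the proof.  Were phi := valuation_at on none of the rays
    spanned by the evaluations, the separating units u a would have a sum X
    with 1 + X = X but 1 + nu X != nu X at b.  An empty A needs no separate
    argument: then X = 0 = 1 in R. *)
Lemma valuation_at_ray : exists (a : A) (t : rat), 0 <= t /\
  forall u : unit_group, (valuation_at u)%:~R = t * (val u a)%:~R.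
Proof.
apply: contrapT => noray.
have sep a : exists u : unit_group, 0 <= val u a /\ valuation_at u < 0.
  case: (collinear_or_separated valuation_at (coord a \o val)) => // -[t tP].
  by case: noray; exists a, t.
have [u uP] := choice sep.
pose X := \sum_a monomial (u a).
have X1 : 1 + X = X.
  apply: trop_val_inj; apply/ffunP => a.
  (* The summand u a alone absorbs 1 at the point a. *)
  rewrite !rmorphD !rmorph1 !rmorph_sum !ffunE !sum_ffunE (bigD1 a) //= addrA.
  congr (_ + _); rewrite monomialE ffunE.
  by congr Some; apply: max_r; case: (uP a).
have := congr1 (fun F => val (nu F) b) X1.
rewrite !rmorphD !rmorph1 !rmorph_sum !ffunE !sum_ffunE.
under eq_bigr do rewrite valuation_atE.
by apply/eqP/trop_sum_lt0 => a; case: (uP a).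
Qed.

End Valuation.
End UnitExponents.

(** * Finite Laurent-generating sets *)

Section Generated.
Variables (T : pzSemiRingType) (S : set T).

(** generated_subsemiring as a boolean predicate, to which the structure of a
    subsemiring can be attached. *)
Definition generated_pred : {pred T} := mem (generated_subsemiring S).

Fact generated_closed : semiring_closed generated_pred.
Proof.
split; split.
- by rewrite in_setE => M [[[]]]; rewrite in_setE.
- move=> x y; rewrite !in_setE => xS yS M MS.
  have [[[_ MD] _] _] := MS.
  by have := MD x y; rewrite !in_setE; apply; [exact: xS | exact: yS].
- by rewrite in_setE => M [[_ []]]; rewrite in_setE.
- move=> x y; rewrite !in_setE => xS yS M MS.
  have [[_ [_ MM]] _] := MS.
  by have := MM x y; rewrite !in_setE; apply; [exact: xS | exact: yS].
Qed.

HB.instance Definition _ :=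
  GRing.isSemiringClosed.Build T generated_pred generated_closed.

End Generated.

Lemma subset_generated (T : pzSemiRingType) (S : set T) x :
  S x -> x \in generated_pred S.
Proof. by move=> Sx; rewrite in_setE; apply: sub_smallest Sx. Qed.

(** The tropical vectors of a finite generating set g of the group
    unit_exponents R.  They Laurent-generate a subsemiring R' of R, and the
    exponents of units of R' form a group containing g, hence all exponents of
    units of R, among them those of any given Laurent-generating set of R. *)
Lemma finite_laurent_generating (A : finType)
    (R : semiringClosed (posSemiring A)) :
  laurent_generated R ->
  exists S : set (posSemiring A),
    [/\ laurent_generates S R, finite_set S &
        forall F, S F -> F \in R /\
          exists2 f, f \in unit_exponents R & val F = trop_vec f].
Proof.
move=> [S [S_unit R_gen]].
have [f _|g [gR g_gen]] :=
    @subgroup_fg _ [seq (@coord A a : {additive _ -> int}) | a <- enum A]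
      (unit_exponents R : zmodClosed _).
  rewrite all_map => /allP f0.
  by apply/ffunP => a; rewrite ffunE; apply/eqP/f0; rewrite mem_enum.
pose S' : set (posSemiring A) :=
  [set F | val F \in map (@trop_vec A) g]%classic.
have S'P F : S' F -> exists f (G : posSemiring A), [/\ f \in unit_exponents R,
    val F = trop_vec f, F \in R, G \in R & F * G = 1].
  move=> /mapP[f /gR fR Ff]; exists f.
  have /unit_exponentsP[F' [G [F'R GR F'f Gf]]] := fR.
  have FF' : F = F' by apply: val_inj; rewrite F'f.
  exists G; split=> //; first by rewrite FF'.
  by apply: val_inj; rewrite rmorphM /= Ff Gf -trop_vecD subrr trop_vec0.
have SR x : (S `|` inverses S)%classic x -> x \in R.
  move=> Sx; suff : [set x | x \in R]%classic x by [].
  by rewrite R_gen; apply: sub_smallest Sx.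
exists S'; split; last first.
- by move=> F /S'P[f [G [fR Ff FR _ _]]]; split=> //; exists f.
- apply: (@finite_preimage _ _ [set` map (@trop_vec A) g]%classic val).
    by move=> x y _ _ /val_inj.
  exact: finite_seq.
split=> [F /S'P[f [G [_ _ _ _ FG]]]|]; first by exists G.
pose R' : semiringClosed (posSemiring A) :=
  generated_pred (S' `|` inverses S')%classic.
have gR' : {subset g <= unit_exponents R'}.
  move=> f fg; have /unit_exponentsP[F [G [_ _ Ff Gf]]] := gR f fg.
  have S'F : S' F by rewrite /S' /= Ff map_f.
  apply/unit_exponentsP; exists F, G; split=> //; apply: subset_generated.
    by left.
  right; exists F => //.
  by apply: val_inj; rewrite rmorphM /= Ff Gf -trop_vecD subrr trop_vec0.
apply/seteqP; split=> [x|].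
  rewrite R_gen; apply: smallest_sub; first exact: generated_closed.
  have SR' y z : S y -> y * z = 1 -> y \in R' /\ z \in R'.
    move=> Sy yz.
    have [||f [fR yf zf]] := mulr_eq1_unit_exponent _ _ yz (R := R).
    - by apply: SR; left.
    - by apply: SR; right; exists y.
    have /unit_exponentsP[F [G [FR' GR' Ff Gf]]] := g_gen _ gR' _ fR.
    have -> : y = F by apply: val_inj; rewrite yf.
    by have -> : z = G by apply: val_inj; rewrite zf.
  move=> y [Sy|[z Sz zy]].
    by have [z yz] := S_unit _ Sy; have [] := SR' _ _ Sy yz; rewrite in_setE.
  by have [_] := SR' _ _ Sz zy; rewrite in_setE.
apply: smallest_sub.
  have [[R0 RD] [R1 RM]] := GRing.semiringClosedP R.
  split; split; rewrite ?in_setE // => x y; rewrite !in_setE;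
  [exact: RD | exact: RM].
move=> y [/S'P[f [G []]] //|[x /S'P[f [G [_ _ _ GR xG]]] xy]].
by rewrite /= -[y]mulr1 -xG mulrA [y * x]mulrC xy mul1r.
Qed.

Theorem theorem1p1 (A B : finType) (R : semiringClosed (posSemiring A))
    (hR : laurent_generated R)
    (nu : {rmorphism subsemiring R -> posSemiring B}) :
  geometric nu.
Proof.
have [S [S_gen S_fin S_R]] := finite_laurent_generating hR.
exists S; split=> //; split=> //.
  by move=> F /S_R[FR [f fR Ff]]; split=> //; exact: unit_exponent_deg0 fR Ff.
move=> b; have [a [t [t0 tP]]] := valuation_at_ray nu b.
exists a, t; split=> // F /S_R[_ [f fR Ff]].
have -> : F = monomial (Sub f fR : unit_group R).
  by apply: trop_val_inj; rewrite monomialE.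
by rewrite valuation_atE [val (val _)]monomialE ffunE /= tP.
Qed.
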